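(* Let $A$ be a non-degenerate three-dimensional evolution algebra over a field $\mathbb{K}$ with natural basis $\{e_1,e_2,e_3\}$. Suppose that $\mathrm{Soc}(A)=\mathrm{span}(\{e_1+e_2,e_2+e_3\})$ and that $\mathrm{Soc}(A)$ does not have the extension property. Moreover, suppose that there is no natural basis $\{e_1',e_2',e_3'\}$ of $A$ such that $\mathrm{Soc}(A)=\mathrm{span}(\{e_1',e_2'+e_3'\})$. Then: (1) $\mathrm{Soc}(A)=A^2$ is a minimal ideal and $\mathrm{ssi}(A)=1$. (2) There exist $b_0\in B$ and $\varphi\in\mathrm{End}_{\mathbb{K}}(B)$ such that $A\cong\mathrm{Adj}_2(B,\varphi,b_0,0)$, where $B=\mathrm{Soc}(A)$ is a two-dimensional algebra. The moduli set for this class of algebras is $(\mathrm{End}_{\mathbb{K}}(B)\times B)/\mathcal{G}$, where $\mathcal{G}=\mathrm{Aut}(B)\times B\times\mathbb{K}^\times$. Thus the isomorphism classes of algebras $\mathrm{Adj}_2(B,\varphi,b_0,0)$ (for $B$ fixed) are in one-to-one correspondence with the elements of the set $(\mathrm{End}_{\mathbb{K}}(B)\times B)/\mathcal{G}$ of $\mathcal{G}$-orbits.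
   Context: An evolution algebra over $\mathbb{K}$ is a finite-dimensional (not necessarily associative) $\mathbb{K}$-algebra with a basis $\{e_i\}$ (a natural basis) with $e_ie_j=0$ for $i\ne j$; it is non-degenerate if $\mathrm{ann}(A)=\{x:xA=Ax=0\}=0$, equivalently $e_i^2\ne0$ for all $i$. $A^2$ is the linear span of all products. $\mathrm{Soc}(A)$ is the sum of all minimal ideals $I$ of $A$ with $AI\ne\{0\}$. The socle chain is $\mathrm{Soc}^{(1)}(A)=\mathrm{Soc}(A)$, $\mathrm{Soc}^{(n+1)}(A)/\mathrm{Soc}^{(n)}(A)=\mathrm{Soc}(A/\mathrm{Soc}^{(n)}(A))$, and $\mathrm{ssi}(A)$ is the least $n\ge1$ with $\mathrm{Soc}^{(n)}(A)=\mathrm{Soc}^{(n+k)}(A)$ for all $k>0$. A subalgebra has the extension property if it has a natural basis that can be extended to a natural basis of $A$. $L_b$ denotes left multiplication by $b$ in $B$; $\mathrm{End}_{\mathbb{K}}(B)$ is the space of linear maps $B\to B$; $\mathrm{Aut}(B)$ is the group of algebra automorphisms of $B$; $\mathbb{K}^\times=\mathbb{K}\setminus\{0\}$. For a commutative algebra $B$ (not necessarily an evolution algebra), a linear map $\varphi:B\to B$, $b_0\in B$ and $k_0\in\mathbb{K}$, $\mathrm{Adj}_2(B,\varphi,b_0,k_0)$ is the vector space $B\times\mathbb{K}$ with product $(b,\lambda)(b',\lambda')=(bb'+\lambda'\varphi(b)+\lambda\varphi(b')+\lambda\lambda'b_0,\ \lambda\lambda'k_0)$. $\mathcal{G}=\mathrm{Aut}(B)\times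 B\times\mathbb{K}^\times$ has product $(\theta,b,k)(\theta',b',k')=(\theta\theta',\theta(b')+k'b,kk')$ and acts on $\mathrm{End}_{\mathbb{K}}(B)\times B$ by $(\theta,b,k)\cdot(\varphi,b_0)=(\varphi',b_0')$, where $\varphi'=k^{-1}(\theta\varphi\theta^{-1}-L_b)$ and $b_0'=k^{-2}(\theta(b_0)-b^2-2k\varphi'(b))$. A moduli set for a class of algebras is a group acting on a set such that the isomorphism classes of algebras in the class are in one-to-one correspondence with the orbits. *)

(* Defs.v *)
From HB Require Import structures.
From mathcomp Require Import all_boot all_order all_algebra.
From mathcomp Require Import boolp classical_sets.

Set Implicit Arguments.
Unset Strict Implicit.
Unset Printing Implicit Defensive.

Import GRing.Theory.
Local Open Scope ring_scope.
Local Open Scope classical_set_scope.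

(* Finite-dimensional algebras, neither associative nor unital nor            *)
(* commutative in general.                                                    *)
Record nalg (K : fieldType) := NAlg {
  nasort :> vectType K;
  namul : {bilinear nasort -> nasort -> nasort}
}.
Arguments NAlg {K} nasort namul.

Notation "x ** y" := (namul _ x y) (at level 40, left associativity) : ring_scope.

Section Span.
Variables (K : fieldType) (V : vectType K).

Fact lspan_exists (S : set V) :
  exists U : {vspace V}, forall x, x \in U <->
    exists2 s : seq V, {in s, forall y, S y} & x \in <<s>>%VS.
Proof.
pose P n := `[< exists2 s : seq V, {in s, forall y, S y} & \dim <<s>>%VS = n >].
have exP : exists n, P n by exists (\dim <<[::] : seq V>>%VS); apply/asboolP; exists [::].
have ubP n : P n -> (n <= \dim {:V})%N.
  by case/asboolP=> s _ <-; apply: dimvS; apply: subvf.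
case: (ex_maxnP exP ubP) => n /asboolP[s sS sn] maxn.
exists <<s>>%VS => x; split=> [xs|[t tS xt]]; first by exists s.
have /eqP eq_st : <<s>>%VS == <<s ++ t>>%VS.
  rewrite eqEdim {1}span_cat addvSl sn /=; apply: maxn; apply/asboolP.
  by exists (s ++ t) => // y; rewrite mem_cat => /orP[/sS|/tS].
by rewrite eq_st span_cat (subvP (addvSr _ _)).
Qed.

(* linear span of an arbitrary, possibly infinite, set of vectors *)
Definition lspan (S : set V) : {vspace V} := sval (cid (lspan_exists S)).

Lemma lspanP (S : set V) x : x \in lspan S <->
  exists2 s : seq V, {in s, forall y, S y} & x \in <<s>>%VS.
Proof. exact: (svalP (cid (lspan_exists S))). Qed.

Definition vsum (F : set {vspace V}) : {vspace V} :=
  lspan [set x | exists2 I, F I & x \in I].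

End Span.

Section Algebra.
Variables (K : fieldType) (A : nalg K).
Implicit Types (U I : {vspace A}) (X : seq A).

Definition nondegenerate :=
  forall x : A, (forall a : A, x ** a = 0 /\ a ** x = 0) -> x = 0.

(* X is a natural basis of the subspace U; the elements of a basis are        *)
(* pairwise distinct, so that x != y expresses that the indices differ.       *)
Definition natural_basis_of U X :=
  basis_of U X /\ {in X &, forall x y, x != y -> x ** y = 0}.

Definition natural_basis X := natural_basis_of fullv X.

Definition extension_property U :=
  exists X Y, natural_basis_of U X /\ natural_basis (X ++ Y).

Definition algsq : {vspace A} := lspan [set z | exists x y : A, z = x ** y].

Definition is_ideal I :=
  forall a x : A, x \in I -> a ** x \in I /\ x ** a \in I.

Definition minimal_ideal I :=
  [/\ is_ideal I, I != 0%VS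
    & forall J, is_ideal J -> (J <= I)%VS -> J = 0%VS \/ J = I].

Definition socle : {vspace A} :=
  vsum [set I | minimal_ideal I /\ exists a x : A, x \in I /\ a ** x != 0].

Lemma socle_ideal : is_ideal socle.
Proof.
suff fsocle (f : A -> A) : linear f ->
    (forall I, is_ideal I -> forall x, x \in I -> f x \in I) ->
    forall x, x \in socle -> f x \in socle.
  move=> a x xS; split.
    apply: (fsocle (namul A a)) xS; first exact: linearPr.
    by move=> I idI y /(idI a)[].
  apply: (fsocle (fun y => y ** a)) xS; first by move=> k u v; rewrite linearPl.
  by move=> I idI y /(idI a)[].
move=> lin_f fI x /lspanP[s sS xs].
pose fL := HB.pack_for {linear A -> A} f
  (GRing.isLinear.Build K A A *:%R f lin_f).
have fE y : linfun fL y = f y by rewrite lfunE.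
rewrite -fE memv_preim; move: x xs; apply/subvP/span_subvP => y ys.
have [I [minI AI] yI] := sS y ys.
rewrite -memv_preim fE; apply/lspanP; exists [:: f y]; last first.
  by rewrite span_seq1 memv_line.
move=> z; rewrite inE => /eqP->; exists I; first by split.
by apply: fI yI; case: minI.
Qed.

Definition lmul (b : A) : 'End(A) := linfun (namul A b).

Section Subalgebra.
Variable U : {vspace A}.

Definition sub_mul (x y : subvs_of U) : subvs_of U :=
  vsproj U (vsval x ** vsval y).

Fact sub_mul_bilinear : bilinear_for *:%R *:%R sub_mul.
Proof.
by split=> u a x y; rewrite /sub_mul;
  rewrite ?linearPl ?linearPr linearP ?linearPl ?linearPr.
Qed.

HB.instance Definition _ := bilinear_isBilinear.Build K _ _ _ _ _ sub_mul
  sub_mul_bilinear.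

(* The subspace U as an algebra. vsproj makes the product total; it is the    *)
(* product of A as soon as U is closed under it, see subalg_mulE.             *)
Definition subalg : nalg K := NAlg (subvs_of U) sub_mul.

Lemma subalg_mulE (x y : subalg) : vsval x ** vsval y \in U ->
  vsval (x ** y) = vsval x ** vsval y.
Proof. exact: vsprojK. Qed.

End Subalgebra.

Section Quotient.
Variable I : {vspace A}.

(* The quotient space A / I is modelled on the complement I^C, with canonical *)
(* surjection the projection along I.                                         *)
Definition quo_pi : 'Hom(A, subvs_of I^C) :=
  linfun (vsproj I^C \o daddv_pi I^C I).

Definition quo_mul (x y : subvs_of I^C) : subvs_of I^C :=
  quo_pi (vsval x ** vsval y).

Fact quo_mul_bilinear : bilinear_for *:%R *:%R quo_mul.
Proof.
by split=> u a x y; rewrite /quo_mul;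
  rewrite ?linearPl ?linearPr linearP ?linearPl ?linearPr.
Qed.

HB.instance Definition _ := bilinear_isBilinear.Build K _ _ _ _ _ quo_mul
  quo_mul_bilinear.

Definition quo : nalg K := NAlg (subvs_of I^C) quo_mul.

Lemma quo_piK (x : quo) : quo_pi (vsval x) = x.
Proof.
rewrite lfunE /= daddv_pi_id ?vsvalK ?subvsP //.
by rewrite capvC capv_compl.
Qed.

Lemma quo_pi_eq0 x : (quo_pi x == 0) = (x \in I).
Proof.
have capC : (I^C :&: I)%VS = 0%VS by rewrite capvC capv_compl.
rewrite lfunE /= -val_eqE /= vsprojK ?memv_pi //.
have /(daddv_pi_add capC) dx : x \in (I^C + I)%VS.
  by rewrite addvC addv_complf memvf.
apply/eqP/idP=> [x0|xI]; first by rewrite -dx x0 add0r memv_pi.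
apply/(addIr (daddv_pi I I^C x)); rewrite dx add0r daddv_pi_id //.
exact: capv_compl.
Qed.

Lemma quo_pi_mul : is_ideal I ->
  {morph (quo_pi : A -> quo) : x y / x ** y >-> x ** y}.
Proof.
move=> idI x y; rewrite /= /quo_mul.
set x' := vsval _; set y' := vsval _.
have piE z : quo_pi (vsval (quo_pi z)) = quo_pi z by exact: quo_piK.
have xI : x - x' \in I by rewrite -quo_pi_eq0 linearB /= piE subrr.
have yI : y - y' \in I by rewrite -quo_pi_eq0 linearB /= piE subrr.
apply/eqP; rewrite -subr_eq0 -linearB quo_pi_eq0.
have -> : x ** y - x' ** y' = (x - x') ** y + x' ** (y - y').
  by rewrite linearBl linearBr addrA subrK.
by rewrite memvD //; [case: (idI y _ xI) | case: (idI x' _ yI)].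
Qed.

End Quotient.

End Algebra.

Section SocleChain.
Variables (K : fieldType) (A : nalg K).

Definition soc_step (I : {vspace A}) : {vspace A} :=
  (quo_pi I @^-1: socle (quo I))%VS.

(* Soc^(n)(A) for n >= 1; the value at n = 0 is irrelevant. *)
Definition soc_chain (n : nat) : {vspace A} := iter n.-1 soc_step (socle A).

Definition soc_stable (n : nat) : Prop :=
  forall k, (0 < k)%N -> soc_chain n = soc_chain (n + k)%N.

Lemma soc_step_sub I : (I <= soc_step I)%VS.
Proof.
by apply/subvP=> x; rewrite -quo_pi_eq0 => /eqP x0; rewrite -memv_preim x0 mem0v.
Qed.

Fact ssi_exists : exists n, (0 < n)%N && `[< soc_stable n >].
Proof.
pose c n := iter n soc_step (socle A).
have cS n : (c n <= c n.+1)%VS by apply: soc_step_sub.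
have [n eqn] : exists n, c n = c n.+1.
  apply: contrapT => /forallNP neq.
  have lt n : (n <= \dim (c n))%N.
    elim: n => // n IHn; apply: leq_ltn_trans IHn _.
    rewrite ltn_neqAle dimvS // andbT; apply/negP=> /eqP dn.
    by apply: (neq n); apply/eqP; rewrite eqEdim cS dn /=.
  have := leq_trans (lt (\dim {:A}).+1) (dimvS (subvf _)).
  by rewrite ltnn.
exists n.+1; apply/asboolP => k _; rewrite /soc_chain /= -/(c n) -/(c (n + k)%N).
elim: k => [|k IHk]; first by rewrite addn0.
by rewrite addnS [RHS]/= -/(c (n + k)%N) -IHk.
Qed.

Definition ssi : nat := ex_minn ssi_exists.

Lemma ssiP : [/\ (0 < ssi)%N, soc_stable ssi
  & forall n, (0 < n)%N -> soc_stable n -> (ssi <= n)%N].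
Proof.
rewrite /ssi; case: ex_minnP => n /andP[n0 /asboolP ns] minn; split=> // m m0 ms.
by apply: minn; rewrite m0; apply/asboolP.
Qed.

End SocleChain.

Definition is_alg_iso (K : fieldType) (A B : nalg K) (f : 'Hom(A, B)) : Prop :=
  bijective f /\ forall x y, f (x ** y) = f x ** f y.

Definition alg_iso (K : fieldType) (A B : nalg K) : Prop :=
  exists f : 'Hom(A, B), is_alg_iso f.

Section Adj2.
Variables (K : fieldType) (B : nalg K) (phi : 'End(B)) (b0 : B) (k0 : K).

Definition adj2_mul (x y : B * K^o) : B * K^o :=
  (x.1 ** y.1 + y.2 *: phi x.1 + x.2 *: phi y.1 + (x.2 * y.2) *: b0,
   x.2 * y.2 * k0).

Fact adj2_mul_bilinear : bilinear_for *:%R *:%R adj2_mul.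
Proof.
have ACA (a b c d e f g h : B) :
    a + b + (c + d) + (e + f) + (g + h) = a + c + e + g + (b + d + f + h).
  by rewrite (addrACA a) (addrACA (a + c)) (addrACA (a + c + e)).
have scaleE (c : K) (d : K^o) : c *: d = c * d by [].
split=> [[u1 u2] a [x1 x2] [y1 y2]|[u1 u2] a [x1 x2] [y1 y2]]; congr pair;
  rewrite /= ?linearPl ?linearPr ?linearP /= ?scaleE.
- by rewrite !scalerDr !scalerDl !scalerA mulrDl scalerDl !mulrA ACA.
- by rewrite !mulrDl !mulrA.
- rewrite !scalerDr !scalerDl !scalerA mulrDr scalerDl !mulrA ACA.
  by rewrite (mulrC u2 a).
- by rewrite mulrDr !mulrDl !mulrA (mulrC u2 a).
Qed.

HB.instance Definition _ := bilinear_isBilinear.Build K _ _ _ _ _ adj2_mul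
  adj2_mul_bilinear.

Definition Adj2 : nalg K := NAlg (B * K^o)%type adj2_mul.

End Adj2.

Section UnitGroup.
Variable K : fieldType.

Definition kunit := {k : K | k != 0}.
HB.instance Definition _ := Choice.on kunit.
Implicit Types k : kunit.

Definition kunit_one : kunit := Sub 1 (oner_neq0 K).
Definition kunit_mul k k' : kunit :=
  Sub (val k * val k') (mulf_neq0 (valP k) (valP k')).
Definition kunit_inv k : kunit := Sub (val k)^-1 (invr_neq0 (valP k)).

Fact kunit_mulA : associative kunit_mul.
Proof. by move=> x y z; apply: val_inj; rewrite /= mulrA. Qed.
Fact kunit_mul1 : left_id kunit_one kunit_mul.
Proof. by move=> x; apply: val_inj; rewrite /= mul1r. Qed.
Fact kunit_mulr1 : right_id kunit_one kunit_mul.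
Proof. by move=> x; apply: val_inj; rewrite /= mulr1. Qed.
Fact kunit_mulV : left_inverse kunit_one kunit_inv kunit_mul.
Proof. by move=> x; apply: val_inj; rewrite /= mulVf // (valP x). Qed.
Fact kunit_mulrV : right_inverse kunit_one kunit_inv kunit_mul.
Proof. by move=> x; apply: val_inj; rewrite /= mulfV // (valP x). Qed.

HB.instance Definition _ := isGroup.Build kunit
  kunit_mulA kunit_mul1 kunit_mulr1 kunit_mulV kunit_mulrV.

End UnitGroup.

Section AutGroup.
Variables (K : fieldType) (B : nalg K).

Definition aut := {f : 'End(B) | `[< is_alg_iso f >]}.
HB.instance Definition _ := Choice.on aut.
Implicit Types t : aut.

Lemma autP t : is_alg_iso (val t).
Proof. exact/asboolP/(valP t). Qed.

Lemma aut_lker t : lker (val t) == 0%VS.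
Proof. by apply/lker0P; apply: bij_inj; case: (autP t). Qed.

Fact aut_one_subproof : `[< is_alg_iso (\1%VF : 'End(B)) >].
Proof.
by apply/asboolP; split=> [|x y]; [exists id => x|]; rewrite !lfunE.
Qed.
Fact aut_mul_subproof t t' : `[< is_alg_iso (val t \o val t')%VF >].
Proof.
apply/asboolP; have [[bij_t tM] [bij_t' t'M]] := (autP t, autP t').
split=> [|x y]; last by rewrite !lfunE /= t'M tM.
by apply: (eq_bij (bij_comp bij_t bij_t')) => x; rewrite /= lfunE.
Qed.
Fact aut_inv_subproof t : `[< is_alg_iso (val t)^-1%VF >].
Proof.
have [tK tVK] := (lker0_lfunK (aut_lker t), lker0_lfunVK (aut_lker t)).
apply/asboolP; split=> [|x y]; first by exists (val t).
by apply: (can_inj tK); rewrite (autP t).2 !tVK.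
Qed.

Definition aut_one : aut := Sub \1%VF aut_one_subproof.
Definition aut_mul t t' : aut := Sub (val t \o val t')%VF (aut_mul_subproof t t').
Definition aut_inv t : aut := Sub (val t)^-1%VF (aut_inv_subproof t).

Fact aut_mulA : associative aut_mul.
Proof. by move=> x y z; apply: val_inj; rewrite /= comp_lfunA. Qed.
Fact aut_mul1 : left_id aut_one aut_mul.
Proof. by move=> x; apply: val_inj; rewrite /= comp_lfun1l. Qed.
Fact aut_mulr1 : right_id aut_one aut_mul.
Proof. by move=> x; apply: val_inj; rewrite /= comp_lfun1r. Qed.
Fact aut_mulV : left_inverse aut_one aut_inv aut_mul.
Proof. by move=> x; apply: val_inj; rewrite /= lker0_compVf // aut_lker. Qed.
Fact aut_mulrV : right_inverse aut_one aut_inv aut_mul.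
Proof. by move=> x; apply: val_inj; rewrite /= lker0_compfV // aut_lker. Qed.

HB.instance Definition _ := isGroup.Build aut
  aut_mulA aut_mul1 aut_mulr1 aut_mulV aut_mulrV.

End AutGroup.

Section AdjGroup.
Variables (K : fieldType) (B : nalg K).

Definition adjG : Type := (aut B * B * kunit K)%type.
HB.instance Definition _ := Choice.on adjG.
Implicit Types g h : adjG.

Definition adjG_mul g h : adjG :=
  let: (t, b, k) := g in let: (t', b', k') := h in
  ((t * t')%g, val t b' + val k' *: b, (k * k')%g).
Definition adjG_one : adjG := (1%g, 0, 1%g).
Definition adjG_inv g : adjG :=
  let: (t, b, k) := g in (t^-1%g, - ((val k)^-1 *: val (t^-1)%g b), k^-1%g).

Fact adjG_mulA : associative adjG_mul.
Proof.
move=> [[t b] k] [[t' b'] k'] [[t'' b''] k'']; rewrite /= !mulgA; congr (_, _, _).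
rewrite /= lfunE /= linearD linearZ /= scalerDr scalerA addrA.
by rewrite [val k'' * _]mulrC.
Qed.
Fact adjG_mul1 : left_id adjG_one adjG_mul.
Proof.
by move=> [[t b] k]; rewrite /= !mul1g /= lfunE /= scaler0 addr0.
Qed.
Fact adjG_mulr1 : right_id adjG_one adjG_mul.
Proof.
by move=> [[t b] k]; rewrite /= !mulg1 /= linear0 scale1r add0r.
Qed.
Fact adjG_mulV : left_inverse adjG_one adjG_inv adjG_mul.
Proof.
move=> [[t b] k]; rewrite /= !mulVg /= scalerN scalerA mulfV ?(valP k) //.
by rewrite scale1r subrr.
Qed.
Fact adjG_mulrV : right_inverse adjG_one adjG_inv adjG_mul.
Proof.
move=> [[t b] k]; rewrite /= !mulgV /= linearN linearZ /=.
by rewrite lker0_lfunVK ?aut_lker // addrC subrr.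
Qed.

HB.instance Definition _ := isGroup.Build adjG
  adjG_mulA adjG_mul1 adjG_mulr1 adjG_mulV adjG_mulrV.

Definition adj_act (g : adjG) (x : 'End(B) * B) : 'End(B) * B :=
  let: (t, b, k) := g in
  let theta := val t in
  let phi' := (val k)^-1 *: ((theta \o x.1 \o theta^-1)%VF - lmul b) in
  (phi', (val k) ^- 2 *: (theta x.2 - b ** b - (2 * val k) *: phi' b)).

End AdjGroup.

Definition left_action (G : groupType) (X : Type) (act : G -> X -> X) : Prop :=
  (forall x, act 1%g x = x) /\
  (forall g h x, act (g * h)%g x = act g (act h x)).

Definition same_orbit (G : groupType) (X : Type) (act : G -> X -> X) (x y : X) :=
  exists g, act g x = y.

(* The group G acts on X, and F induces a bijection from the G-orbits to the  *)
(* isomorphism classes of the algebras in C.                                  *)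
Definition moduli_set (K : fieldType) (C : nalg K -> Prop)
    (G : groupType) (X : Type) (act : G -> X -> X) (F : X -> nalg K) : Prop :=
  [/\ left_action act,
      forall x, C (F x),
      forall A, C A -> exists x, alg_iso A (F x)
    & forall x y, alg_iso (F x) (F y) <-> same_orbit act x y].

(* The hypotheses on a three-dimensional evolution algebra A with natural     *)
(* basis e1, e2, e3; both the dimension and the evolution property are        *)
(* carried by natural_basis.                                                  *)
Definition socle_class (K : fieldType) (A : nalg K) (e1 e2 e3 : A) : Prop :=
  [/\ natural_basis [:: e1; e2; e3],
      nondegenerate A,
      socle A = <<[:: e1 + e2; e2 + e3]%R>>%VS,
      ~ extension_property (socle A)
    & ~ exists f1 f2 f3 : A, natural_basis [:: f1; f2; f3] /\
          socle A = <<[:: f1; f2 + f3]%R>>%VS].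

(* Main.v *)
Require Import Defs.
From HB Require Import structures.
From mathcomp Require Import all_boot all_order all_algebra.
From mathcomp Require Import boolp classical_sets ring.

Set Implicit Arguments.
Unset Strict Implicit.
Unset Printing Implicit Defensive.

Import GRing.Theory.
Local Open Scope ring_scope.

(** Every e_i^2 lies in S = Soc(A): multiply the generators e1 + e2 and e2 + e3
of the ideal S by e1, e2, e3.  Hence A^2 is contained in S, the quotient A / S
has zero product and therefore zero socle, and the socle chain stops at S.

S is a minimal ideal for a coordinate reason.  The vectors of S are those with
coordinates (p, p + q, q), so a nonzero one has at least two nonzero
coordinates.  Let J be a nonzero ideal contained in S but different from S.
As S is spanned by minimal ideals, some minimal ideal I inside S is not
contained in J, and I meets J trivially.  For u in J and v in I, the vectors
e_i u = u_i e_i^2 and e_i v = v_i e_i^2 lie in J and in I, and e_i^2 is not 0,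
so u_i v_i = 0 for all i.  Two vectors with disjoint supports of size at least
two do not fit into three coordinates ([socle_minimal]).  As A^2 is a nonzero
ideal inside S, it is S.

The line spanned by e1 is a complement of S, and A^2 lies in S, so A is an
adjunction to the algebra S with phi the multiplication by e1 and b0 = e1^2.
This rests on a universal property ([adj_ext_morphP]): extending a homomorphism
i from B to a commutative algebra by (0, 1) |-> v gives a homomorphism on
Adj2(B, phi, b0, 0) exactly when i(phi(c)) = v i(c) and i(b0) = v^2.

The same property classifies the adjunctions.  An element g = (t, b, k) of the
group gives the linear bijection (c, l) |-> (t(c) + l b, l k) of B x K, this
assignment is multiplicative in g, and g sends x to y exactly when the
bijection is a homomorphism from the adjunction at x to the one at y
([adj_actP]).  Thus the action laws need no computation, and points of an orbit
give isomorphic algebras.  Conversely, an isomorphism of adjunctions comes from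
the group as soon as it preserves B x 0, and it does because B is perfect: the
products (e1 + e2)^2, (e1 + e2)(e2 + e3) and (e2 + e3)^2 span the same space
as the three e_i^2, so that S^2 = A^2 = S ([socle_algebra_perfect]). *)

(** * Products, ideals and the socle chain *)

Section AlgebraLemmas.
Variables (K : fieldType) (A : nalg K).
Implicit Types (x y z : A) (U I J S : {vspace A}).

Definition commutative_alg := forall x y, x ** y = y ** x.

Lemma mem_algsq x y : x ** y \in algsq A.
Proof.
apply/lspanP; exists [:: x ** y]; last by rewrite span_seq1 memv_line.
by move=> z; rewrite inE => /eqP->; exists x, y.
Qed.

Lemma algsq_sub U : (forall x y, x ** y \in U) -> (algsq A <= U)%VS.
Proof.
move=> AU; apply/subvP => x /lspanP[s sS]; apply/subvP/span_subvP => y ys.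
by have [u [v ->]] := sS y ys.
Qed.

Lemma algsq_ideal : is_ideal (algsq A).
Proof. by move=> a x _; split; apply: mem_algsq. Qed.

Lemma ideal_cap I J : is_ideal I -> is_ideal J -> is_ideal (I :&: J)%VS.
Proof.
move=> idI idJ a x; rewrite !memv_cap => /andP[xI xJ].
by have [-> ->] := idI a x xI; have [-> ->] := idJ a x xJ.
Qed.

Lemma sub_vsum (F : set {vspace A}) U :
  (forall I, F I -> (I <= U)%VS) -> (vsum F <= U)%VS.
Proof.
move=> FU; apply/subvP => x /lspanP[s sS]; apply/subvP/span_subvP => y ys.
by have [I /FU/subvP] := sS y ys; apply.
Qed.

Lemma socle_null : (forall x y, x ** y = 0) -> socle A = 0%VS.
Proof.
move=> A0; apply/eqP; rewrite -subv0; apply: sub_vsum => I [_ [a [x [_]]]].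
by rewrite A0 eqxx.
Qed.

End AlgebraLemmas.

(** The quotient by an ideal containing all products has zero product, hence no
minimal ideal I with AI <> 0. *)
Lemma soc_step_algsq (K : fieldType) (A : nalg K) (I : {vspace A}) :
  is_ideal I -> (algsq A <= I)%VS -> soc_step I = I.
Proof.
move=> idI sqI; rewrite /soc_step socle_null => [|x y].
  by apply/vspaceP => x; rewrite -memv_preim memv0 quo_pi_eq0.
rewrite -[x]quo_piK -[y]quo_piK -quo_pi_mul //; apply/eqP.
by rewrite quo_pi_eq0 (subvP sqI) ?mem_algsq.
Qed.

Lemma ssi_eq1 (K : fieldType) (A : nalg K) :
  (algsq A <= socle A)%VS -> ssi A = 1%N.
Proof.
move=> sqS; have [ssi_gt0 _ ssi_min] := ssiP A.
apply/eqP; rewrite eqn_leq ssi_gt0 andbT; apply: ssi_min => // k _.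
rewrite /soc_chain add1n /=; elim: k => //= k <-.
by rewrite soc_step_algsq //; apply: socle_ideal.
Qed.

Lemma alg_iso_bij_sym (K : fieldType) (A B : nalg K) (f : 'Hom(A, B)) :
  injective f -> (forall y, exists x, f x = y) ->
  {morph f : x y / x ** y} -> alg_iso B A.
Proof.
move=> /lker0P kf surj fM; have fK := lker0_lfunK kf.
have fVK : cancel f^-1%VF f by move=> y; have [x <-] := surj y; rewrite fK.
exists f^-1%VF; split; first by exists f.
by move=> x y; apply: (can_inj fK); rewrite fM !fVK.
Qed.

Lemma alg_iso_refl (K : fieldType) (A : nalg K) : alg_iso A A.
Proof. by exists \1%VF; split=> [|x y]; [exists id => x|]; rewrite !lfunE. Qed.

Lemma alg_iso_sym (K : fieldType) (A B : nalg K) : alg_iso A B -> alg_iso B A.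
Proof.
move=> [f [[f' fK f'K] fM]]; apply: (@alg_iso_bij_sym _ _ _ f) => //.
  exact: can_inj fK.
by move=> y; exists (f' y).
Qed.

(** * Evolution algebras with socle spanned by e1 + e2 and e2 + e3 *)

Section NaturalBasis.
Variables (K : fieldType) (A : nalg K) (e1 e2 e3 : A).
Hypothesis nat_e : natural_basis [:: e1; e2; e3].
Implicit Types (x y : A) (I J : {vspace A}).

Definition lc (a b c : K) : A := a *: e1 + b *: e2 + c *: e3.

Lemma lcD a b c a' b' c' :
  lc a b c + lc a' b' c' = lc (a + a') (b + b') (c + c').
Proof. by rewrite /lc !scalerDl (addrACA _ (c *: _)) (addrACA (a *: _)). Qed.

Lemma lcZ k a b c : k *: lc a b c = lc (k * a) (k * b) (k * c).
Proof. by rewrite /lc !scalerDr !scalerA. Qed.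

Lemma lc0 : lc 0 0 0 = 0. Proof. by rewrite /lc !scale0r !addr0. Qed.
Lemma lc100 : lc 1 0 0 = e1. Proof. by rewrite /lc scale1r !scale0r !addr0. Qed.
Lemma lc010 : lc 0 1 0 = e2.
Proof. by rewrite /lc scale1r !scale0r addr0 add0r. Qed.
Lemma lc001 : lc 0 0 1 = e3. Proof. by rewrite /lc scale1r !scale0r !add0r. Qed.
Lemma lc110 : lc 1 1 0 = e1 + e2.
Proof. by rewrite -lc100 -lc010 lcD !(addr0, add0r). Qed.
Lemma lc011 : lc 0 1 1 = e2 + e3.
Proof. by rewrite -lc010 -lc001 lcD !(addr0, add0r). Qed.

Lemma lc_eq0 a b c : lc a b c = 0 -> [/\ a = 0, b = 0 & c = 0].
Proof.
have [/basis_free/(@freeP _ _ _ (in_tuple [:: e1; e2; e3])) fr _] := nat_e => abc.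
have := fr (fun i => [:: a; b; c]`_i).
rewrite !big_ord_recl big_ord0 addr0 /= addrA => /(_ abc) F.
split; [exact: (F ord0) | exact: (F (@Ordinal 3 1 isT)) | exact: (F ord_max)].
Qed.

Lemma lcP x : exists a b c, x = lc a b c.
Proof.
have : x \in <<[:: e1; e2; e3]>>%VS.
  by have [/span_basis-> _] := nat_e; rewrite memvf.
rewrite !span_cons span_nil addv0 addvA => /memv_addP[y yU [z /vlineP[c ->] ->]].
case/memv_addP: yU => [y1 /vlineP[a ->] [z1 /vlineP[b ->] ->]].
by exists a, b, c.
Qed.

(** Only the squares of the natural basis survive in a product; everything about
the multiplication of A is read off from this formula. *)
Lemma lc_mul a b c a' b' c' : lc a b c ** lc a' b' c' =
  (a * a') *: (e1 ** e1) + (b * b') *: (e2 ** e2) + (c * c') *: (e3 ** e3).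
Proof.
have [/basis_free/free_uniq uniq_e orth_e] := nat_e.
have orth x y : x \in [:: e1; e2; e3] -> y \in [:: e1; e2; e3] -> x != y ->
  x ** y = 0 by move=> xX yX; apply: orth_e.
move: uniq_e; rewrite /= !inE !negb_or andbT => /andP[/andP[n12 n13] n23].
have in1 : e1 \in [:: e1; e2; e3] by rewrite !inE eqxx.
have in2 : e2 \in [:: e1; e2; e3] by rewrite !inE eqxx orbT.
have in3 : e3 \in [:: e1; e2; e3] by rewrite !inE eqxx !orbT.
rewrite /lc !linearDl !linearDr /= !linearZl_LR !linearZr_LR /=.
rewrite (orth e1 e2) // (orth e1 e3) // (orth e2 e3) //.
rewrite (orth e2 e1) 1?eq_sym // (orth e3 e1) 1?eq_sym // (orth e3 e2) 1?eq_sym //.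
by rewrite !scaler0 ?(addr0, add0r) !scalerA.
Qed.

Lemma evolution_commutative : commutative_alg A.
Proof.
move=> x y; have [a [b [c ->]]] := lcP x; have [a' [b' [c' ->]]] := lcP y.
by rewrite !lc_mul (mulrC a) (mulrC b) (mulrC c).
Qed.

Lemma algsq_sub_squares (U : {vspace A}) :
  e1 ** e1 \in U -> e2 ** e2 \in U -> e3 ** e3 \in U -> (algsq A <= U)%VS.
Proof.
move=> U1 U2 U3; apply: algsq_sub => x y.
have [a [b [c ->]]] := lcP x; have [a' [b' [c' ->]]] := lcP y.
by rewrite lc_mul !memvD // memvZ.
Qed.

Lemma lc_mul1 a b c : e1 ** lc a b c = a *: (e1 ** e1).
Proof. by rewrite -{1}lc100 lc_mul !mul0r !scale0r mul1r !addr0. Qed.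
Lemma lc_mul2 a b c : e2 ** lc a b c = b *: (e2 ** e2).
Proof. by rewrite -{1}lc010 lc_mul !mul0r !scale0r mul1r addr0 add0r. Qed.
Lemma lc_mul3 a b c : e3 ** lc a b c = c *: (e3 ** e3).
Proof. by rewrite -{1}lc001 lc_mul !mul0r !scale0r mul1r !add0r. Qed.

Hypothesis nd : Defs.nondegenerate A.

(** e_i multiplies A into the line of e_i^2, so e_i^2 = 0 would put e_i in the
annihilator. *)
Lemma square_neq0 : [/\ e1 ** e1 != 0, e2 ** e2 != 0 & e3 ** e3 != 0].
Proof.
have ann0 x : (forall y, x ** y = 0) -> x = 0.
  by move=> x0; apply: nd => y; rewrite (evolution_commutative y) !x0.
have sq0 e : (forall y, exists k, e ** y = k *: (e ** e)) -> e != 0 ->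
    e ** e != 0.
  move=> eM; apply: contraNneq => ee0; apply/eqP; apply: ann0 => y.
  by have [k ->] := eM y; rewrite ee0 scaler0.
have one_neq0 : (1 : K) = 0 -> False by move/eqP; rewrite oner_eq0.
split; apply: sq0 => [y|].
- by have [a [b [c ->]]] := lcP y; exists a; rewrite lc_mul1.
- by apply/eqP; rewrite -lc100 => /lc_eq0[/one_neq0].
- by have [a [b [c ->]]] := lcP y; exists b; rewrite lc_mul2.
- by apply/eqP; rewrite -lc010 => /lc_eq0[_ /one_neq0].
- by have [a [b [c ->]]] := lcP y; exists c; rewrite lc_mul3.
by apply/eqP; rewrite -lc001 => /lc_eq0[_ _ /one_neq0].
Qed.

Hypothesis soc_e : socle A = <<[:: e1 + e2; e2 + e3]%R>>%VS.

Lemma lc_socle p q : lc p (p + q) q = p *: (e1 + e2) + q *: (e2 + e3).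
Proof. by rewrite -lc110 -lc011 !lcZ lcD; congr lc; ring. Qed.

Lemma socle_lcP x : x \in socle A -> exists p q, x = lc p (p + q) q.
Proof.
rewrite soc_e span_cons span_seq1 => /memv_addP[y /vlineP[p ->]].
by case=> z /vlineP[q ->] ->; exists p, q; rewrite lc_socle.
Qed.

Lemma mem_socle12 : e1 + e2 \in socle A.
Proof. by rewrite soc_e memv_span // mem_head. Qed.
Lemma mem_socle23 : e2 + e3 \in socle A.
Proof. by rewrite soc_e memv_span // !inE eqxx orbT. Qed.

Lemma squares_mem_socle :
  [/\ e1 ** e1 \in socle A, e2 ** e2 \in socle A & e3 ** e3 \in socle A].
Proof.
have S12 e := (socle_ideal e mem_socle12).1.
have S23 e := (socle_ideal e mem_socle23).1.
have := (S12 e1, S12 e2, S23 e3).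
by rewrite -lc110 -lc011 lc_mul1 lc_mul2 lc_mul3 !scale1r => -[[]].
Qed.

Lemma algsq_sub_socle : (algsq A <= socle A)%VS.
Proof. by have [S1 S2 S3] := squares_mem_socle; apply: algsq_sub_squares. Qed.

(** If a nonzero ideal J inside the socle misses some minimal ideal I, vectors of
J and of I have disjoint supports, although nonzero vectors of the socle have at
least two of the three coordinates nonzero. *)
Lemma socle_minimal : minimal_ideal (socle A).
Proof.
have [sq1 sq2 sq3] := square_neq0.
split; first exact: socle_ideal.
  apply/eqP=> S0; have := mem_socle12.
  by rewrite S0 memv0 -lc110 => /eqP/lc_eq0[/eqP]; rewrite oner_eq0.
move=> J idJ JS; have [->|J0] := eqVneq J 0%VS; [by left | right].
apply/eqP; rewrite eqEsubv JS /=; apply: sub_vsum => I [minI AI].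
have [idI I0 Imin] := minI.
have /Imin[|J0'|<-] := ideal_cap idI idJ; [exact: capvSl | | exact: capvSr].
have IS : (I <= socle A)%VS.
  apply/subvP => x xI; apply/lspanP; exists [:: x].
    by move=> z; rewrite inE => /eqP->; exists I.
  by rewrite span_seq1 memv_line.
have [p [q u_pq]] := socle_lcP (subvP JS _ (memv_pick J)).
have [r [s v_rs]] := socle_lcP (subvP IS _ (memv_pick I)).
(* J and I meet trivially, so no nonzero z has nonzero multiples in both. *)
have cap0 k l (z : A) : z != 0 -> k *: z \in J -> l *: z \in I ->
    (k == 0) || (l == 0).
  move=> z0 kJ lI; apply: contraNT z0; rewrite negb_or => /andP[k0 l0].
  have : z \in (I :&: J)%VS.
    by move: kJ lI; rewrite memv_cap !rpredZeq (negPf k0) (negPf l0) /= => -> ->.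
  by rewrite J0' memv0.
have mulJ e := (idJ e _ (memv_pick J)).1.
have mulI e := (idI e _ (memv_pick I)).1.
have := cap0 p r _ sq1; have := cap0 (p + q) (r + s) _ sq2.
have := cap0 q s _ sq3; move: (mulJ e1) (mulJ e2) (mulJ e3).
move: (mulI e1) (mulI e2) (mulI e3); rewrite u_pq v_rs !lc_mul1 !lc_mul2 !lc_mul3.
move=> I1 I2 I3 J1 J2 J3 /(_ J3 I3) qs /(_ J2 I2) pqrs /(_ J1 I1) pr.
move: J0 I0; rewrite -!vpick0 u_pq v_rs => u0 v0.
(* One of p, r, one of p + q, r + s and one of q, s vanish: two of the three
   zeros fall on the same vector, which is then 0. *)
case/orP: pr => /eqP ?; subst; case/orP: qs => /eqP ?; subst.
- by rewrite addr0 lc0 eqxx in u0.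
- case/orP: pqrs; rewrite ?add0r ?addr0 => /eqP ?; subst.
    by rewrite addr0 lc0 eqxx in u0.
  by rewrite addr0 lc0 eqxx in v0.
- case/orP: pqrs; rewrite ?add0r ?addr0 => /eqP ?; subst.
    by rewrite addr0 lc0 eqxx in u0.
  by rewrite addr0 lc0 eqxx in v0.
by rewrite addr0 lc0 eqxx in v0.
Qed.

Lemma socle_algsq : socle A = algsq A.
Proof.
have [_ _ /(_ _ (@algsq_ideal _ A) algsq_sub_socle)[sq0|->]] // := socle_minimal.
have [/eqP[]] := square_neq0; apply/eqP.
by rewrite -memv0 -sq0 mem_algsq.
Qed.

(** By [lc_mul] the generators have the products e1^2 + e2^2, e2^2 and
e2^2 + e3^2, from which the three squares, hence all of A^2 = Soc(A), are
recovered. *)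
Lemma socle_algebra_perfect : algsq (subalg (socle A)) = fullv.
Proof.
set B := subalg (socle A).
(* The square of the socle, seen as a subspace of A. *)
pose W := (linfun (@vsval _ _ (socle A)) @: algsq B)%VS.
have mulS x y : x ** y \in socle A by rewrite (subvP algsq_sub_socle) ?mem_algsq.
have mulW x y : x \in socle A -> y \in socle A -> x ** y \in W.
  move=> xS yS; pose x' : B := vsproj _ x; pose y' : B := vsproj _ y.
  have -> : x ** y = linfun (@vsval _ _ (socle A)) (x' ** y').
    by rewrite lfunE /= subalg_mulE /= !vsprojK.
  exact: memv_img (mem_algsq x' y').
have sqW : (algsq A <= W)%VS.
  have [S1 S2] := (mem_socle12, mem_socle23).
  have W2 : e2 ** e2 \in W.
    have := mulW _ _ S1 S2; rewrite -lc110 -lc011 lc_mul.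
    by rewrite !(mulr0, mul0r, mulr1, scale0r, scale1r, addr0, add0r).
  apply: algsq_sub_squares => //.
    have := mulW _ _ S1 S1; rewrite -lc110 lc_mul.
    by rewrite !(mulr0, mul0r, mulr1, scale0r, scale1r, addr0) rpredDr.
  have := mulW _ _ S2 S2; rewrite -lc011 lc_mul.
  by rewrite !(mulr0, mul0r, mulr1, scale0r, scale1r, add0r) rpredDl.
apply/eqP; rewrite eqEsubv subvf; apply/subvP => x _.
have : vsval x \in W by rewrite (subvP sqW) // -socle_algsq subvsP.
by case/memv_imgP => y yB; rewrite lfunE => /val_inj->.
Qed.

Lemma socle_dim : \dim (socle A) = 2%N.
Proof.
have one_neq0 : (1 : K) = 0 -> False by move/eqP; rewrite oner_eq0.
rewrite soc_e; apply/eqP/(_ : free _).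
rewrite free_cons seq1_free span_seq1; apply/andP; split; last first.
  by apply/eqP; rewrite -lc011 => /lc_eq0[_ /one_neq0].
apply/vlineP => -[k eq_k]; have : lc 1 (1 - k) (- k) = 0.
  have -> : lc 1 (1 - k) (- k) = e1 + e2 + (- k) *: (e2 + e3).
    by rewrite -lc110 -lc011 lcZ lcD; congr lc; ring.
  by rewrite eq_k scaleNr subrr.
by case/lc_eq0 => /one_neq0.
Qed.

Lemma e1_notin_socle : e1 \notin socle A.
Proof.
apply/negP => /socle_lcP[p [q e1E]].
have : lc (1 - p) (- (p + q)) (- q) = 0.
  have -> : lc (1 - p) (- (p + q)) (- q) = lc 1 0 0 + (-1) *: lc p (p + q) q.
    by rewrite lcZ lcD; congr lc; ring.
  by rewrite lc100 -e1E scaleN1r subrr.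
case/lc_eq0 => p1 pq0 q0; case/eqP: (oner_neq0 K).
have -> : 1 = (1 - p) - (- (p + q)) + (- q) by ring.
by rewrite p1 pq0 q0 subrr addr0.
Qed.

(** The vectors of the socle are those with coordinates (p, p + q, q), which
determines the coefficient a - b + c of e1. *)
Lemma socle_decomp x : exists2 u, u \in socle A & exists l, x = u + l *: e1.
Proof.
have [a [b [c ->]]] := lcP x; exists (lc (b - c) (b - c + c) c).
  by rewrite lc_socle memvD // memvZ ?mem_socle12 ?mem_socle23.
by exists (a - b + c); rewrite -lc100 lcZ lcD; congr lc; ring.
Qed.

End NaturalBasis.

(** * A universal property of adjunctions *)

Section AdjExtension.
Variables (K : fieldType) (B V : vectType K) (i : 'Hom(B, V)) (v : V).

Definition adj_ext_fun (p : B * K^o) : V := i p.1 + p.2 *: v.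

Fact adj_ext_linear : linear adj_ext_fun.
Proof.
move=> k [u1 u2] [v1 v2].
by rewrite /adj_ext_fun /= linearP scalerDl scalerDr scalerA addrACA.
Qed.

HB.instance Definition _ :=
  GRing.isLinear.Build K (B * K^o)%type V *:%R adj_ext_fun adj_ext_linear.

Definition adj_ext : 'Hom((B * K^o)%type, V) := linfun adj_ext_fun.

Lemma adj_extE p : adj_ext p = i p.1 + p.2 *: v.
Proof. by rewrite lfunE. Qed.

End AdjExtension.

(** The adjunction is generated over B by (0, 1), whose products with (c, 0) and
with itself are (phi(c), 0) and (b0, 0): these are the only relations to test. *)
Lemma adj_ext_morphP (K : fieldType) (A B : nalg K) (i : 'Hom(B, A)) (v : A)
    (phi : 'End(B)) (b0 : B) :
  commutative_alg A -> {morph i : c d / c ** d} ->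
  {morph (adj_ext i v : Adj2 phi b0 0 -> A) : p q / p ** q} <->
  (forall c, i (phi c) = v ** i c) /\ i b0 = v ** v.
Proof.
move=> comA iM; split=> [eM | [phiE b0E] [c l] [d m]].
  split=> [c|].
    have := eM (0, 1) (c, 0); rewrite !adj_extE /= linear0l linear0.
    by rewrite !(mulr0, mul0r, scale0r, scale1r, linear0, addr0, add0r).
  have := eM (0, 1) (0, 1); rewrite !adj_extE /= linear0l !linear0.
  by rewrite !(mulr1, mulr0, scale0r, scale1r, scaler0, linear0, addr0, add0r).
rewrite !adj_extE /= mulr0 scale0r addr0 !linearD !linearZ /= iM !phiE b0E.
rewrite !linearDl /= !linearZl_LR /= (comA (i c) v) !scalerDr !scalerA.
by rewrite (mulrC m) addrA (addrAC (i c ** i d)).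
Qed.

(** Take for phi the multiplication by e and b0 = e^2; both land in S because S
contains all products. *)
Lemma adj2_of_hyperplane (K : fieldType) (A B : nalg K) (S : {vspace A}) (e : A) :
  commutative_alg A -> (algsq A <= S)%VS -> e \notin S ->
  (forall x, exists2 u, u \in S & exists l, x = u + l *: e) ->
  alg_iso B (subalg S) ->
  exists (phi : 'End(B)) (b0 : B), alg_iso A (Adj2 phi b0 0).
Proof.
move=> comA sqS eS decomp [h [[h' hK h'K] hM]].
have mulS x y : x ** y \in S by rewrite (subvP sqS) ?mem_algsq.
pose i : 'Hom(B, A) := (linfun (@vsval _ _ S) \o h)%VF.
have iE c : i c = vsval (h c) by rewrite lfunE /= lfunE.
have iM : {morph i : c d / c ** d}.
  by move=> c d; rewrite !iE hM /= subalg_mulE.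
have i_inj : injective i by move=> c d; rewrite !iE => /val_inj/(can_inj hK).
have h_ker : lker h == 0%VS by apply/lker0P/(can_inj hK).
pose j : 'Hom(A, B) := (h^-1 \o linfun (vsproj S))%VF.
have jK x : x \in S -> i (j x) = x.
  move=> xS; rewrite iE !lfunE /= lfunE /= -[vsproj S x]h'K lker0_lfunK // h'K.
  by rewrite vsprojK.
pose phi := (j \o lmul e \o i)%VF.
have phiE c : i (phi c) = e ** i c.
  have -> : phi c = j (e ** i c).
    by rewrite {1}/phi comp_lfunE comp_lfunE [lmul e _]lfunE.
  by rewrite jK.
exists phi, (j (e ** e)).
apply: (@alg_iso_bij_sym _ (Adj2 phi (j (e ** e)) 0) A (adj_ext i e)).
- apply/lker0P; rewrite -subv0; apply/subvP => -[c l].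
  rewrite memv_ker adj_extE /= memv0 => /eqP eq0.
  have iS : i c \in S by rewrite iE subvsP.
  have l0 : l = 0.
    apply/eqP; apply: contraNT eS => l0.
    have : l *: e \in S by rewrite -(rpredDl _ iS) eq0 rpred0.
    by rewrite (rpredZeq S (l : K)) (negPf l0).
  move: eq0; rewrite l0 scale0r addr0 => c0; apply/eqP; congr pair.
  by apply: i_inj; rewrite c0 linear0.
- move=> x; have [u uS [l ->]] := decomp x.
  by exists (j u, l); rewrite adj_extE /= jK.
by apply/adj_ext_morphP => //; split; rewrite ?jK.
Qed.

Lemma adj2_commutative (K : fieldType) (B : nalg K) (phi : 'End(B)) (b0 : B) k0 :
  commutative_alg B -> commutative_alg (Adj2 phi b0 k0).
Proof.
move=> comB [c l] [d m] /=; rewrite /adj2_mul /= (comB c) (mulrC l).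
by rewrite (addrAC (d ** c)).
Qed.

(** * Isomorphisms of adjunctions and orbits *)

Section AdjIsomorphisms.
Variables (K : fieldType) (B : nalg K).
Hypothesis comB : commutative_alg B.
Implicit Types (x y z : 'End(B) * B) (g h : adjG B).

Let Adj x : nalg K := Adj2 x.1 x.2 0.

Definition pair0 (c : B) : B * K^o := (c, 0).
Fact pair0_linear : linear pair0.
Proof. by move=> k c d; congr pair; rewrite /= scaler0 addr0. Qed.
HB.instance Definition _ :=
  GRing.isLinear.Build K B (B * K^o)%type *:%R pair0 pair0_linear.

(** The linear bijection by which the group acts on the common underlying space
of all the adjunctions to B; it maps (0, 1) to (b, k). *)
Definition adjG_map g : 'End((B * K^o)%type) :=
  let: (t, b, k) := g in adj_ext (linfun pair0 \o val t)%VF (b, val k : K^o).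

Lemma adjG_mapE t b k p :
  adjG_map (t, b, k) p = (val t p.1 + p.2 *: b, p.2 * val k).
Proof.
by rewrite adj_extE !lfunE /= lfunE; congr pair; rewrite /= add0r.
Qed.

Lemma adjG_map1 p : adjG_map 1%g p = p.
Proof.
by case: p => c l; rewrite adjG_mapE /= lfunE /= scaler0 addr0 mulr1.
Qed.

Lemma adjG_mapM g h p : adjG_map (g * h)%g p = adjG_map g (adjG_map h p).
Proof.
case: g h p => [[t b] k] [[t' b'] k'] [c l].
rewrite !adjG_mapE /= lfunE /= !linearD !linearZ /= scalerA addrA.
by rewrite (mulrC (sval k')) (mulrC (sval k)) mulrA.
Qed.

(** Clearing the denominators k and k^2 in the action formula; the result has the
shape of the two conditions in [adj_ext_morphP]. *)
Lemma adj_actE t b k phi b0 phi' b0' :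
  adj_act ((t, b, k) : adjG B) (phi, b0) = (phi', b0') <->
  (forall c, val t (phi c) = b ** val t c + val k *: phi' (val t c)) /\
  val t b0 = b ** b + (2 * val k) *: phi' b + val k ^+ 2 *: b0'.
Proof.
have k0 := valP k; have k20 : val k ^+ 2 != 0 by rewrite expf_neq0.
have tK c := lker0_lfunK (aut_lker t) c.
have tVK c := lker0_lfunVK (aut_lker t) c.
rewrite /adj_act; set psi := _ *: _.
have psiE c : val k *: psi c = val t (phi ((val t)^-1%VF c)) - b ** c.
  rewrite /psi scale_lfunE add_lfunE opp_lfunE !comp_lfunE [lmul b c]lfunE.
  by rewrite scalerA mulfV // scale1r.
split=> [[<- <-]|[phiE b0E]].
  split=> [c|]; first by rewrite psiE tK addrC subrK.
  rewrite scalerA mulfV // scale1r /=.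
  by rewrite -[X in _ + X]addrA -opprD addrC addNKr.
have -> : psi = phi'.
  apply/lfunP => c; apply: (scalerI k0); rewrite psiE phiE tVK.
  by rewrite addrC addKr.
congr pair; apply: (scalerI k20); rewrite scalerA mulfV // scale1r b0E.
by rewrite -addrA -opprD addrC addKr.
Qed.

(** The action is transport of structure: with i(c) = (t(c), 0) and v = (b, k),
the conditions v i(c) = i(phi(c)) and v^2 = i(b0) are those of [adj_actE]. *)
Lemma adj_actP g x y : adj_act g x = y <->
  {morph (adjG_map g : Adj x -> Adj y) : p q / p ** q}.
Proof.
case: g x y => [[t b] k] [phi b0] [phi' b0'].
apply: (iff_trans (adj_actE _ _ _ _ _ _ _)).
have [_ tM] := autP t; pose A' := Adj2 phi' b0' 0.
pose i : 'Hom(B, A') := (linfun pair0 \o val t)%VF.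
have iE c : i c = (val t c, 0) by rewrite lfunE /= lfunE.
have iM : {morph i : c d / c ** d}.
  move=> c d; rewrite !iE tM; congr pair => /=; last by rewrite mulr0.
  by rewrite !(mulr0, scale0r, addr0).
have comA' : commutative_alg A' by apply: adj2_commutative.
pose v : A' := (b, val k : K^o).
have mulE c : v ** i c = (b ** val t c + val k *: phi' (val t c), 0).
  rewrite iE; congr pair => /=; last by rewrite !mulr0.
  by rewrite !(mulr0, scale0r, addr0, add0r).
have sqE : v ** v = (b ** b + (2 * val k) *: phi' b + val k ^+ 2 *: b0', 0).
  congr pair => /=; last by rewrite !mulr0.
  by rewrite mulr_natl mulr2n scalerDl addrA.
have morphP := @adj_ext_morphP _ _ _ i v phi b0 comA' iM.
apply: (iff_trans _ (iff_sym morphP)); split=> -[phiE b0E].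
  by split=> [c|]; rewrite ?mulE ?sqE iE ?phiE ?b0E.
split=> [c|]; first by have := phiE c; rewrite mulE iE => -[].
by have := b0E; rewrite sqE iE => -[].
Qed.

(** Homomorphisms compose, and [adj_actP] turns this into the action laws. *)
Lemma adj_act_left_action : left_action (@adj_act K B).
Proof.
split=> [x|g h x].
  by apply/adj_actP => p q; rewrite !adjG_map1.
have hM := (adj_actP h x _).1 erefl; have gM := (adj_actP g _ _).1 erefl.
by apply/adj_actP => p q; rewrite !adjG_mapM hM gM.
Qed.

Lemma adjG_map_bij g : bijective (adjG_map g).
Proof.
exists (adjG_map g^-1%g) => p.
  by rewrite -adjG_mapM mulVg adjG_map1.
by rewrite -adjG_mapM mulgV adjG_map1.
Qed.

Hypothesis perfectB : algsq B = fullv.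

(** Products in an adjunction with k0 = 0 have last coordinate 0.  As B is spanned
by products, f maps B x 0 into itself, so that f is triangular. *)
Lemma adj2_iso_adjG_map x y (f : 'Hom(Adj x, Adj y)) :
  is_alg_iso f -> exists g, f =1 adjG_map g.
Proof.
move=> [[f' fK f'K] fM].
have fE0 c d : f (c ** d, 0) = f (c, 0) ** f (d, 0).
  by rewrite -fM; congr (f _); congr pair; rewrite /= ?mulr0 // !scale0r !addr0.
pose psi : 'Hom(B, K^o) := linfun (snd \o (f \o pair0)).
have f0 c : (f (c, 0)).2 = 0.
  have psiE d : psi d = (f (d, 0)).2 by rewrite lfunE.
  rewrite -psiE; apply/eqP; rewrite -memv_ker.
  have : c \in algsq B by rewrite perfectB memvf.
  apply/subvP/algsq_sub => {}c d.
  by rewrite memv_ker psiE fE0 /= mulr0.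
pose theta : 'End(B) := linfun (fst \o (f \o pair0)).
have fE c : f (c, 0) = (theta c, 0) by rewrite [LHS]surjective_pairing f0 lfunE.
have thetaM c d : theta (c ** d) = theta c ** theta d.
  have := fE0 c d; rewrite !fE => /(congr1 fst) /= ->.
  by rewrite !scale0r mulr0 scale0r !addr0.
have theta_inj : injective theta.
  move=> c d cd; have : f (c, 0) = f (d, 0) by rewrite !fE cd.
  by move/(can_inj fK) => [].
have theta_ker : lker theta == 0%VS by apply/lker0P.
have theta_iso : `[< is_alg_iso (theta : 'Hom(B, B)) >].
  apply/asboolP; split=> //; exists theta^-1%VF.
    exact: lker0_lfunK.
  exact: lker0_lfunVK.
have fcl c l : f (c, l) = (theta c + l *: (f (0, 1)).1, l * (f (0, 1)).2).
  have -> : (c, l) = pair0 c + l *: ((0, 1) : B * K^o).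
    by congr pair; rewrite /= ?scaler0 ?addr0 // add0r [RHS]mulr1.
  rewrite linearD linearZ /= fE; congr pair => /=.
  by rewrite add0r.
(* Otherwise (0, 1) would not be in the image of f. *)
have k0 : (f (0, 1)).2 != 0 :> K.
  apply/eqP => k0; have := congr1 snd (f'K (0, 1)).
  case: (f' _) => c l; rewrite fcl k0 /= mulr0 => /esym/eqP.
  by rewrite oner_eq0.
exists (Sub theta theta_iso : aut B, (f (0, 1)).1, Sub (f (0, 1)).2 k0 : kunit K).
by case=> c l; rewrite fcl adjG_mapE.
Qed.

Lemma adj2_iso_orbit x y :
  alg_iso (Adj x) (Adj y) <-> same_orbit (@adj_act K B) x y.
Proof.
split=> [[f isof]|[g gxy]].
  have [g fg] := adj2_iso_adjG_map isof; exists g; apply/adj_actP => p q.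
  by rewrite -!fg isof.2.
exists (adjG_map g : 'Hom(Adj x, Adj y)); split; first exact: adjG_map_bij.
exact/adj_actP.
Qed.

End AdjIsomorphisms.

(** * The classification *)

Lemma socle_class_adj2 (K : fieldType) (A B : nalg K) (e1 e2 e3 : A) :
  socle_class e1 e2 e3 -> alg_iso (subalg (socle A)) B ->
  exists (phi : 'End(B)) (b0 : B), alg_iso A (Adj2 phi b0 0).
Proof.
move=> [nat_e nd soc_e _ _] /alg_iso_sym.
apply: (adj2_of_hyperplane (e := e1)).
- exact: evolution_commutative nat_e.
- exact: algsq_sub_socle nat_e soc_e.
- exact: e1_notin_socle nat_e soc_e.
exact: socle_decomp nat_e soc_e.
Qed.

Theorem theorem6p14 (K : fieldType) (A : nalg K) (e1 e2 e3 : A)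
    (hA : socle_class e1 e2 e3) :
  let B : nalg K := subalg (socle A) in
  let adj (x : 'End(B) * B) : nalg K := Adj2 x.1 x.2 0 in
  [/\ [/\ socle A = algsq A, minimal_ideal (socle A) & ssi A = 1%N],
      \dim {:B} = 2%N /\
        (exists (b0 : B) (phi : 'End(B)), alg_iso A (Adj2 phi b0 0)),
      moduli_set
        (fun A' : nalg K =>
           exists (phi : 'End(B)) (b0 : B), alg_iso A' (Adj2 phi b0 0))
        (@adj_act K B) adj
    & forall (A' : nalg K) (f1 f2 f3 : A'), socle_class f1 f2 f3 ->
        alg_iso (subalg (socle A')) B ->
        exists x : 'End(B) * B, alg_iso A' (adj x)].
Proof.
move=> B adj; have [nat_e nd soc_e _ _] := hA.
have comA := evolution_commutative nat_e.
have comB : commutative_alg B.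
  by move=> x y; apply: val_inj; rewrite /= /sub_mul comA.
have perfectB : algsq B = fullv by exact: socle_algebra_perfect nat_e nd soc_e.
split.
- split; [exact: socle_algsq nat_e nd soc_e | exact: socle_minimal nat_e nd soc_e |].
  by apply: ssi_eq1; apply: algsq_sub_socle nat_e soc_e.
- split; first by rewrite dimvf /= -(socle_dim nat_e soc_e).
  by have [phi [b0 iso]] := socle_class_adj2 hA (alg_iso_refl B); exists b0, phi.
- split; first exact: adj_act_left_action.
  + by move=> x; exists x.1, x.2; apply: alg_iso_refl.
  + by move=> A' [phi [b0 iso]]; exists (phi, b0).
  by move=> x y; apply: adj2_iso_orbit.
move=> A' f1 f2 f3 hA' /(socle_class_adj2 hA')[phi [b0 iso]].
by exists (phi, b0).
Qed.
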